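(* Let $\mathbf K_I,\mathbf K_J,\mathbf K_L$ be Kuranishi charts such that $F_I\cap F_L\subset F_J$, and let $\widehat\Phi_{IJ}:\mathbf K_I\to\mathbf K_J$ and $\widehat\Phi_{JL}:\mathbf K_J\to\mathbf K_L$ be coordinate changes, with domains $U_{IJ}\subset U_I$, $U_{JL}\subset U_J$ and embeddings $\phi_{IJ}:U_{IJ}\to U_J$, $\widehat\phi_{IJ}:E_I\to E_J$, $\phi_{JL}:U_{JL}\to U_L$, $\widehat\phi_{JL}:E_J\to E_L$. Then the following holds. (i) The domain $U_{IJL}:=\phi_{IJ}^{-1}(U_{JL})\subset U_I$ defines a restriction $\mathbf K_I|_{U_{IJL}}$ to $F_I\cap F_L$. (ii) The compositions $\phi_{IJL}:=\phi_{JL}\circ\phi_{IJ}:U_{IJL}\to U_L$ and $\widehat\phi_{IJL}:=\widehat\phi_{JL}\circ\widehat\phi_{IJ}:E_I\to E_L$ define a coordinate change $\widehat\Phi_{IJL}:\mathbf K_I|_{U_{IJL}}\to\mathbf K_L$.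
   Context: $X$ is a compact metrizable space. A Kuranishi chart (trivial isotropy) for $X$ with footprint a nonempty open $F\subset X$ is $\mathbf K=(U,E,s,\psi)$ with $U$ a finite-dimensional smooth manifold (without boundary), $E$ a finite-dimensional real vector space, $s:U\to E$ smooth, and $\psi:s^{-1}(0)\to X$ a homeomorphism onto $F$. A restriction of $\mathbf K$ to an open subset $F'\subset F$ is a chart $\mathbf K|_{U'}=(U',E,s|_{U'},\psi|_{U'\cap s^{-1}(0)})$ with $U'\subset U$ open and $U'\cap s^{-1}(0)=\psi^{-1}(F')$. A coordinate change from $\mathbf K_I$ to $\mathbf K_J$ (where $F_I\cap F_J\neq\emptyset$) is a map $\mathbf K_I|_{U_{IJ}}\to\mathbf K_J$ defined on a restriction of $\mathbf K_I$ to $F_I\cap F_J$: it consists of an open $U_{IJ}\subset U_I$ with $U_{IJ}\cap s_I^{-1}(0)=\psi_I^{-1}(F_I\cap F_J)$, a smooth embedding $\phi_{IJ}:U_{IJ}\to U_J$ and a linear injection $\widehat\phi_{IJ}:E_I\to E_J$ such that $s_J\circ\phi_{IJ}=\widehat\phi_{IJ}\circ s_I$ on $U_{IJ}$, $\phi_{IJ}=\psi_J^{-1}\circ\psi_I$ on $U_{IJ}\cap s_I^{-1}(0)$, and the index condition holds: for all $u\in U_{IJ}$, $d_u\phi_{IJ}(\ker d_us_I)=\ker d_{\phi_{IJ}(u)}s_J$, and $E_I=\operatorname{im}d_us_I\oplus C$ implies $E_J=\operatorname{im}d_{\phi_{IJ}(u)}s_J\oplus\widehat\phi_{IJ}(C)$.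 As always for coordinate changes, the footprints involved are assumed to overlap, in particular $F_I\cap F_L\neq\emptyset$. *)

(* Defs.v *)
From HB Require Import structures.
From mathcomp Require Import all_boot all_order all_algebra.
From mathcomp Require Import all_classical all_reals all_analysis.

Set Implicit Arguments.
Unset Strict Implicit.
Unset Printing Implicit Defensive.

Import Order.TTheory GRing.Theory Num.Theory.
Import numFieldNormedType.Exports.
Import VectorInternalTheory.

Local Open Scope classical_set_scope.
Local Open Scope ring_scope.

Definition metrizable (R : realType) (X : topologicalType) : Prop :=
  exists d : X -> X -> R,
    [/\ forall x y, d x y = 0 <-> x = y,
        forall x y, d x y = d y x,
        forall x y z, d x z <= d x y + d y z
      & forall (x : X) (A : set X),
          nbhs x A <-> exists2 e : R, 0 < e & [set y | d x y < e] `<=` A].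

(* The last conjunct says that [f : A -> B] is open for the subspace topologies,
   i.e. that the inverse bijection is continuous. *)
Definition homeo_onto (S T : topologicalType) (A : set S) (f : S -> T)
    (B : set T) : Prop :=
  [/\ set_bij A B f, {within A, continuous f}
    & forall O : set S, open O ->
        exists2 O' : set T, open O' & f @` (A `&` O) = B `&` O'].

(* [A] is meant to be open, so that ['d f x] and ['D_v f x] at a point of [A]
   do not depend on the values of [f] outside [A]. *)
Fixpoint Ck_on (R : realType) (m n k : nat) (A : set 'rV[R]_m)
    (f : 'rV[R]_m -> 'rV[R]_n) : Prop :=
  if k is k'.+1 then
    (forall x, A x -> differentiable f x) /\
    (forall v, Ck_on k' A (fun x => 'D_v f x))
  else forall x, A x -> {for x, continuous f}.

Definition smooth_on (R : realType) (m n : nat) (A : set 'rV[R]_m)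
    (f : 'rV[R]_m -> 'rV[R]_n) : Prop := forall k, Ck_on k A f.

(* A homeomorphism from the open set [cdom] onto an open subset of R^n; the
   values of [cmap] outside [cdom] and of [cinv] outside the image are junk. *)
Record chart (R : realType) (M : topologicalType) (n : nat) := Chart {
  cdom : set M;
  cmap :> M -> 'rV[R]_n;
  cinv : 'rV[R]_n -> M;
  cdom_open : open cdom;
  cimg_open : open (cmap @` cdom);
  cmap_continuous : forall x, cdom x -> {for x, continuous cmap};
  cinv_continuous : forall y, (cmap @` cdom) y -> {for y, continuous cinv};
  cmapK : forall x, cdom x -> cinv (cmap x) = x }.

Record manifold (R : realType) := Manifold {
  mcarrier :> topologicalType;
  mdim : nat;
  atlas : set (chart R mcarrier mdim);
  manifold_hausdorff : hausdorff_space mcarrier;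
  manifold_second_countable : @second_countable mcarrier;
  atlas_cover : forall x : mcarrier, exists2 c, atlas c & cdom c x;
  atlas_compatible : forall c c', atlas c -> atlas c' ->
    smooth_on (c @` (cdom c `&` cdom c')) (c' \o cinv c) }.
Arguments atlas {R} m.

Definition chart_at (R : realType) (M : manifold R) (x : M) :
  chart R M (mdim M) := s2val (cid2 (atlas_cover x)).

(* [A] is an open subset of [M]; only the restriction of [f] to [A] matters. *)
Definition smooth_map (R : realType) (M N : manifold R) (A : set M)
    (f : M -> N) : Prop :=
  (forall x, A x -> {for x, continuous f}) /\
  forall c c', atlas M c -> atlas N c' ->
    smooth_on (c @` (A `&` cdom c `&` f @^-1` cdom c')) (c' \o f \o cinv c).

(* A finite-dimensional real vector space carries the smooth structure for which
   the linear isomorphism [v2r : E -> 'rV_(dim E)] is a diffeomorphism. *)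
Definition smooth_fun (R : realType) (M : manifold R) (E : vectType R)
    (A : set M) (s : M -> E) : Prop :=
  forall c, atlas M c ->
    smooth_on (c @` (A `&` cdom c)) ((v2r : E -> _) \o s \o cinv c).

(* The tangent space of [M] at [x] is identified with R^(dim M) through the chart
   [chart_at x]; accordingly, differentials are linear maps out of
   ['rV_(mdim M)]. *)
Definition mdiff (R : realType) (M N : manifold R) (f : M -> N) (x : M) :
    'Hom('rV[R]_(mdim M), 'rV[R]_(mdim N)) :=
  linfun ('d (chart_at (f x) \o f \o cinv (chart_at x)) (chart_at x x)).

Definition fdiff (R : realType) (M : manifold R) (E : vectType R)
    (s : M -> E) (x : M) : 'Hom('rV[R]_(mdim M), E) :=
  linfun ((r2v : _ -> E) \o
          'd ((v2r : E -> _) \o s \o cinv (chart_at x)) (chart_at x x)).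

Definition smooth_embedding (R : realType) (M N : manifold R) (A : set M)
    (f : M -> N) : Prop :=
  [/\ smooth_map A f,
      forall x, A x -> lker (mdiff f x) = 0%VS
    & homeo_onto A f (f @` A)].

Definition direct_sum (R : realType) (E : vectType R) (V W : {vspace E}) : Prop :=
  (V + W = fullv)%VS /\ (V :&: W = 0)%VS.

(* [(U, E, s, psi)] is a Kuranishi chart with footprint [F], where the domain is
   the open submanifold [U] of [M].  Only the values of [s] on [U], and those of
   [psi] on the zero set of [s] in [U], matter. *)
Definition is_kuranishi (R : realType) (X : topologicalType) (M : manifold R)
    (U : set M) (E : vectType R) (s : M -> E) (psi : M -> X) (F : set X) : Prop :=
  [/\ open U, smooth_fun U s, open F, F !=set0
    & homeo_onto (U `&` s @^-1` [set 0]) psi F].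

Record kuranishi_chart (R : realType) (X : topologicalType) := KuranishiChart {
  kdom : manifold R;
  kobs : vectType R;
  ksec : kdom -> kobs;
  kpsi : kdom -> X;
  kfoot : set X;
  kuranishiP : is_kuranishi [set: kdom] ksec kpsi kfoot }.
Arguments kdom {R X} k.
Arguments kobs {R X} k.
Arguments ksec {R X} k.
Arguments kpsi {R X} k.
Arguments kfoot {R X} k.

Definition kzero (R : realType) (X : topologicalType)
  (K : kuranishi_chart R X) : set (kdom K) := ksec K @^-1` [set 0].
Arguments kzero {R X} K.

Definition is_restriction (R : realType) (X : topologicalType)
    (K : kuranishi_chart R X) (F' : set X) (U' : set (kdom K)) : Prop :=
  [/\ open F', F' `<=` kfoot K, open U',
      U' `&` kzero K = kzero K `&` kpsi K @^-1` F'
    & is_kuranishi U' (ksec K) (kpsi K) F'].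
Arguments is_restriction {R X} K F' U'.

Definition index_condition (R : realType) (X : topologicalType)
    (KI KJ : kuranishi_chart R X) (U : set (kdom KI))
    (phi : kdom KI -> kdom KJ) (hphi : 'Hom(kobs KI, kobs KJ)) : Prop :=
  forall u, U u ->
    (mdiff phi u @: lker (fdiff (ksec KI) u))%VS
      = lker (fdiff (ksec KJ) (phi u)) /\
    forall C : {vspace kobs KI},
      direct_sum (limg (fdiff (ksec KI) u)) C ->
      direct_sum (limg (fdiff (ksec KJ) (phi u))) (hphi @: C)%VS.

(* [phi] is a total function of which only the restriction to the domain [U] of
   the coordinate change matters.  The clause on the zero set says that
   [phi = psi_J^-1 \o psi_I] there. *)
Definition coordinate_change (R : realType) (X : topologicalType)
    (KI KJ : kuranishi_chart R X) (U : set (kdom KI))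
    (phi : kdom KI -> kdom KJ) (hphi : 'Hom(kobs KI, kobs KJ)) : Prop :=
  [/\ kfoot KI `&` kfoot KJ !=set0 /\
      is_restriction KI (kfoot KI `&` kfoot KJ) U,
      smooth_embedding U phi /\ lker hphi = 0%VS,
      forall u, U u -> ksec KJ (phi u) = hphi (ksec KI u),
      forall u, U u -> kzero KI u -> kzero KJ (phi u) /\ kpsi KJ (phi u) = kpsi KI u
    & index_condition U phi hphi].
Arguments coordinate_change {R X} KI KJ U phi hphi.

(* Main.v *)
(* On the zero set, [phi_IJ] covers the identity of [X]; since the intersection
   of [F_I] and [F_L] lies in [F_J], the zeros of [s_I] over it are in [U_IJ] and
   are sent to zeros of [s_J] over [F_J] and [F_L], which lie in [U_JL].  This
   gives (i).  For (ii), everything composes: the index condition through the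
   chain rule [d phi_IJL = d phi_JL \o d phi_IJ], and smoothness through
     [D_v (g \o f) = \sum_j (D_v f)_j *: (D_(e_j) g \o f)],
   which yields the C^k chain rule by induction on k. *)
Require Import Defs.
From HB Require Import structures.
From mathcomp Require Import all_boot all_order all_algebra.
From mathcomp Require Import all_classical all_reals all_analysis.

Set Implicit Arguments.
Unset Strict Implicit.
Unset Printing Implicit Defensive.

Import Order.TTheory GRing.Theory Num.Theory.
Import numFieldNormedType.Exports.

Local Open Scope classical_set_scope.
Local Open Scope ring_scope.

(** * Differentials depend only on germs *)

Section NearEqDiff.
Variables (R : numFieldType) (V W : normedModType R).
Implicit Types f g : V -> W.

(** The expansion of [g] is stated with the differential of [f], before [g] is known to be
    differentiable: uniqueness then identifies ['d g x], and existence follows. *)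
Lemma near_eq_diff_locally f g x : {near x, f =1 g} -> differentiable f x ->
  g \o shift x = cst (g x) + 'd f x +o_ 0 id.
Proof.
move=> fg df; have [_ /eqaddoP fx] := (diff_locallyP _ _).1 df.
have fgx : f x = g x := nbhs_singleton fg.
apply/eqaddoP => e e0; move/fx: (e0) => {}fx.
have fg0 : \forall h \near 0, f (h + x) = g (h + x).
  move: fg; rewrite (near_shift 0 x (fun y => f y = g y)).
  by apply: filterS => h /=; rewrite subr0.
apply: filter_app fx; apply: filterS fg0 => h fgh.
by rewrite !fctE /= fgh -fgx.
Qed.

Lemma near_eq_diff f g x : {near x, f =1 g} -> differentiable f x ->
  'd g x = 'd f x :> (V -> W).
Proof.
move=> fg df; apply: diff_unique; first exact: diff_continuous.
exact: near_eq_diff_locally.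
Qed.

Lemma near_eq_differentiable f g x : {near x, f =1 g} ->
  differentiable f x -> differentiable g x.
Proof.
move=> fg df; apply/diff_locallyP; rewrite (near_eq_diff fg df).
by split; [exact: diff_continuous|exact: near_eq_diff_locally].
Qed.

End NearEqDiff.

(** * Product rule for scaling, and coordinate functions *)

Section ScaleDiff.
Variables (R : realFieldType) (V W : normedModType R).

Lemma scaler_bilinear : bilinear_for
  (GRing.Scale.Law.clone _ _ *:%R _) (GRing.Scale.Law.clone _ _ *:%R _)
  (@GRing.scale R W : R -> W -> W).
Proof.
split=> [u'|u] a x y /=; first by rewrite scalerDl scalerA.
by rewrite scalerDr !scalerA mulrC.
Qed.
HB.instance Definition _ := bilinear_isBilinear.Build R R W W _ _
  (@GRing.scale R W : R -> W -> W) scaler_bilinear.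

Lemma is_diff_scale (a : V -> R) (f : V -> W) x :
  differentiable a x -> differentiable f x ->
  is_diff x (fun y => a y *: f y) (fun v => a x *: 'd f x v + 'd a x v *: f x).
Proof.
move=> da df; pose b := (@GRing.scale R W : R -> W -> W).
have cb : continuous (fun p : R * W => b p.1 p.2).
  by move=> p; exact: scale_continuous.
have dp := differentiable_pair da df.
have db : differentiable (fun p => b p.1 p.2) (a x, f x).
  exact: differentiable_bilin.
rewrite (_ : (fun y => _) = (fun p => b p.1 p.2) \o (fun y => (a y, f y)))//.
apply: DiffDef; first exact: differentiable_comp.
by rewrite diff_comp // diff_pair // diff_bilin.
Qed.

End ScaleDiff.

Section CoordDiff.
Variables (R : realType) (V : normedModType R) (n : nat).

Lemma is_diff_coord (f : V -> 'rV[R]_n) j x : differentiable f x ->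
  is_diff x (fun y => f y 0 j) (fun v => 'd f x v 0 j).
Proof.
move=> df; pose p (N : 'rV[R]_n) := N 0 j.
have lp : linear p by move=> a u v; rewrite /p !mxE.
pose pM := GRing.isLinear.Build _ _ _ _ _ lp.
(* The coordinate map is packed as a linear map so that [diff_lin] makes it its own differential. *)
pose pL : {linear 'rV[R]_n -> R} := HB.pack p pM.
have dp := @differentiable_coord R 1 n (f x) 0 j.
rewrite (_ : (fun y => _) = p \o f)//.
apply: DiffDef; first exact: differentiable_comp.
rewrite diff_comp // -[p]/(pL : _ -> _) diff_lin //.
exact: coord_continuous.
Qed.

End CoordDiff.

(** * Calculus of C^k maps between Euclidean spaces *)

Section Ck.
Variables (R : realType) (m : nat).
Implicit Types A : set 'rV[R]_m.

Lemma sub_Ck_on n k A B (f : 'rV[R]_m -> 'rV[R]_n) :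
  B `<=` A -> Ck_on k A f -> Ck_on k B f.
Proof.
move=> BA; elim: k f => [|k IH] f /=; first by move=> cf x /BA /cf.
by move=> [df Df]; split=> [x /BA /df //|v]; exact: IH.
Qed.

(** [Ck_on] imposes its conditions point by point. Passing to singletons allows a different local
    expression of [f] at each point. *)
Lemma Ck_on_set1 n k A (f : 'rV[R]_m -> 'rV[R]_n) :
  (forall x, A x -> Ck_on k [set x] f) -> Ck_on k A f.
Proof.
elim: k f => [|k IH] f /=; first by move=> cf x /cf; exact.
move=> df; split=> [x /df [+ _]|v]; first exact.
by apply: IH => x /df [_].
Qed.

Lemma near_eq_Ck_on n k (f g : 'rV[R]_m -> 'rV[R]_n) x :
  {near x, f =1 g} -> Ck_on k [set x] f -> Ck_on k [set x] g.
Proof.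
elim: k f g => [|k IH] f g fg /=.
  move=> cf _ ->; rewrite /prop_for /continuous_at -(nbhs_singleton fg).
  by apply: cvg_trans (cf x erefl); apply: near_eq_cvg fg.
move=> [df Df]; split=> [_ ->|v].
  by apply: near_eq_differentiable fg _; exact: df.
(* By [near_join], [f] and [g] agree near every [y] close to [x], so their directional derivatives
   agree near [x] and not just at [x]. *)
apply: IH (Df v); have := near_join fg.
by apply: filterS => y; exact: near_eq_derive.
Qed.

(** Openness of [A] turns equality on [A] into equality of germs at each of its points, which is
    what derivatives see. *)
Lemma eq_Ck_on n k A (f g : 'rV[R]_m -> 'rV[R]_n) : open A ->
  {in A, f =1 g} -> Ck_on k A f -> Ck_on k A g.
Proof.
move=> oA fg cf; apply: Ck_on_set1 => x Ax.
apply: near_eq_Ck_on (sub_Ck_on _ cf); last by move=> _ ->.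
by apply: filterS (open_nbhs_nbhs (conj oA Ax)) => y Ay; rewrite fg ?inE.
Qed.

Lemma Ck_onW n k A (f : 'rV[R]_m -> 'rV[R]_n) : Ck_on k.+1 A f -> Ck_on k A f.
Proof.
elim: k f => [|k IH] f [df Df].
  by move=> x /df; exact: differentiable_continuous.
by split=> // v; exact: IH.
Qed.

Lemma Ck_on_cst n k A (w : 'rV[R]_n) : Ck_on k A (cst w).
Proof.
elim: k w => [|k IH] w /=; first by move=> x _; exact: cst_continuous.
split=> [x _|v]; first exact: differentiable_cst.
rewrite (_ : (fun x => _) = cst 0) //; apply/funext => x; exact: derive_cst.
Qed.

Lemma Ck_onD n k A (f g : 'rV[R]_m -> 'rV[R]_n) : open A ->
  Ck_on k A f -> Ck_on k A g -> Ck_on k A (f \+ g).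
Proof.
move=> oA; elim: k f g => [|k IH] f g /=.
  by move=> cf cg x Ax; apply: continuousD; [exact: cf|exact: cg].
move=> [df Df] [dg Dg]; split=> [x Ax|v].
  by apply: differentiableD; [exact: df|exact: dg].
apply: eq_Ck_on (IH _ _ (Df v) (Dg v)) => // x; rewrite inE => Ax.
by symmetry; apply: deriveD; apply: diff_derivable; [exact: df|exact: dg].
Qed.

Lemma Ck_on_sum n p k A (f : 'I_p -> 'rV[R]_m -> 'rV[R]_n) : open A ->
  (forall j, Ck_on k A (f j)) -> Ck_on k A (fun x => \sum_(j < p) f j x).
Proof.
move=> oA cf; rewrite (_ : (fun x => _) = \sum_(j < p) f j); last first.
  by apply/funext => x; rewrite fct_sumE.
elim/big_ind : _ => [|g h|//]; first exact: Ck_on_cst.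
exact: Ck_onD.
Qed.

(** This is the shape of the summands in the chain rule. By Leibniz, ['D_v] of such a product is a
    sum of two products of the same shape, with one factor differentiated and the other lowered by
    [Ck_onW], so the induction closes. *)
Lemma Ck_on_scale_coord n p k A (f : 'rV[R]_m -> 'rV[R]_n)
    (g : 'rV[R]_m -> 'rV[R]_p) j : open A ->
  Ck_on k A f -> Ck_on k A g -> Ck_on k A (fun x => f x 0 j *: g x).
Proof.
move=> oA; elim: k f g => [|k IH] f g.
  move=> cf cg x Ax; apply: cvgZ (cg x Ax).
  exact: (continuous_comp (cf x Ax) (@coord_continuous _ 1 n 0 j (f x))).
move=> cf cg; have [df Df] := cf; have [dg Dg] := cg.
have dfg x : A x -> is_diff x (fun y => f y 0 j *: g y)
    (fun v => f x 0 j *: 'd g x v + 'd f x v 0 j *: g x).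
  move=> /[dup] /df dfx /dg dgx.
  have [dfj dfjE] := is_diff_coord j dfx.
  by have := is_diff_scale dfj dgx; rewrite dfjE.
split=> [x /dfg [] //|v].
apply: eq_Ck_on (Ck_onD oA (IH _ _ (Ck_onW cf) (Dg v))
                           (IH _ _ (Df v) (Ck_onW cg))) => // x.
rewrite inE => Ax; have [dfgx dE] := dfg _ Ax.
by rewrite /= [RHS]deriveE // dE !deriveE //; [exact: df|exact: dg].
Qed.

End Ck.

Lemma Ck_on_comp (R : realType) (m n p k : nat) (A : set 'rV[R]_m)
    (B : set 'rV[R]_n) (f : 'rV[R]_m -> 'rV[R]_n) (g : 'rV[R]_n -> 'rV[R]_p) :
  open A -> (forall x, A x -> B (f x)) ->
  Ck_on k A f -> Ck_on k B g -> Ck_on k A (g \o f).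
Proof.
move=> oA fAB; elim: k g => [|k IH] g cf cg.
  by move=> x Ax; apply: continuous_comp; [exact: cf|exact/cg/fAB].
have [df Df] := cf; have [dg Dg] := cg.
split=> [x Ax|v].
  by apply: differentiable_comp; [exact: df|exact/dg/fAB].
(* Expand ['d f x v] in the standard basis and use linearity of ['d g (f x)]. *)
have DgfE x : A x ->
    \sum_(j < n) ('D_v f x) 0 j *: ('D_(delta_mx 0 j) g \o f) x =
    'D_v (g \o f) x.
  move=> Ax; have dfx := df x Ax; have dgx := dg _ (fAB _ Ax).
  rewrite [RHS]deriveE; last exact: differentiable_comp.
  rewrite diff_comp //= [X in 'd g _ X]row_sum_delta linear_sum.
  by apply: eq_bigr => j _; rewrite linearZ /= !deriveE.
apply: (@eq_Ck_on _ _ _ k A _ _ oA (fun x Ax => DgfE x (set_mem Ax))).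
apply: Ck_on_sum => // j; apply: Ck_on_scale_coord => //; first exact: Df.
(* The induction is over all [g] with [f] fixed, so it applies to each partial derivative of [g]. *)
by apply: IH (Dg _); exact: Ck_onW.
Qed.

(** * Restriction and composition of homeomorphisms onto their images *)

Lemma open_setI_preimage (S T : topologicalType) (A : set S) (B : set T)
    (f : S -> T) : open A -> (forall x, A x -> {for x, continuous f}) ->
  open B -> open (A `&` f @^-1` B).
Proof.
move=> oA cf oB; rewrite openE => x [Ax Bfx]; apply: filterI.
  exact: open_nbhs_nbhs.
by apply: (cf x Ax); exact: open_nbhs_nbhs.
Qed.

(** Restricting the source to the preimage of [B'] cuts each image [B]&[V] down to [B']&[V], so the
    same [V] witnesses openness. *)
Lemma homeo_onto_restrict (S T : topologicalType) (A : set S) (f : S -> T)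
    (B B' : set T) : B' `<=` B -> homeo_onto A f B ->
  homeo_onto (A `&` f @^-1` B') f B'.
Proof.
move=> B'B [[fAB finj fsurj] cf fopen]; split.
- split; first by move=> x [].
  + by move=> x y /set_mem[Ax _] /set_mem[Ay _]; apply: finj; exact: mem_set.
  + move=> y /[dup] B'y /B'B /fsurj[x Ax fxy].
    by exists x => //; split=> //=; rewrite fxy.
- by apply: continuous_subspaceW cf => x [].
move=> O oO; have [V oV fV] := fopen _ oO; exists V => //.
apply/seteqP; split=> [_ [x [[Ax B'fx] Ox] <-]|y [B'y Vy]].
  by suff [_ Vfx] : (B `&` V) (f x) by []; rewrite -fV; exists x.
have : (B `&` V) y by split=> //; exact: B'B.
rewrite -fV => -[x [Ax Ox] fxy]; exists x => //.
by split=> //; split; rewrite //= fxy.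
Qed.

Lemma homeo_onto_comp (S T U : topologicalType) (A : set S) (B : set T)
    (f : S -> T) (g : T -> U) : open A -> open B ->
  (forall x, A x -> {for x, continuous f}) ->
  (forall y, B y -> {for y, continuous g}) ->
  homeo_onto A f (f @` A) -> homeo_onto B g (g @` B) ->
  homeo_onto (A `&` f @^-1` B) (g \o f) ((g \o f) @` (A `&` f @^-1` B)).
Proof.
move=> oA oB cf cg [[_ finjA _] _ fopen] [[_ ginjB _] _ gopen].
have oC := open_setI_preimage oA cf oB.
have finj x y : A x -> A y -> f x = f y -> x = y.
  by move=> Ax Ay; apply: finjA; exact: mem_set.
have ginj x y : B x -> B y -> g x = g y -> x = y.
  by move=> Bx By; apply: ginjB; exact: mem_set.
split.
- split; first by move=> x Cx; exists x.
  + move=> x y /set_mem[Ax Bx] /set_mem[Ay By] /= gfxy.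
    by apply: finj => //; exact: ginj.
  + by move=> _ [x Cx <-]; exists x.
- apply/subspace_continuousP => x [Ax Bfx].
  apply: cvg_trans (continuous_comp (cf x Ax) (cg _ Bfx)).
  by apply: cvg_app; exact: cvg_within.
(* [O] is first cut down to the domain of the composite; [V] describes its image under [f], and [W]
   the image of [B]&[V] under [g]. *)
move=> O oO; have [V oV fV] := fopen _ (openI oC oO).
have [W oW gW] := gopen _ oV; exists W => //.
apply/seteqP; split=> [_ [x [[Ax Bfx] Ox] <-]|_ [[x [Ax Bfx] <-] Wgfx]].
  split; first by exists x.
  have [_ Vfx] : (f @` A `&` V) (f x) by rewrite -fV; exists x.
  by suff [_ Wgfx] : (g @` B `&` W) (g (f x)) by []; rewrite -gW; exists (f x).
(* Conversely, membership in [W] is pulled back through [g] and then [f]; injectivity forces each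
   preimage found to be the given point. *)
have : (g @` B `&` W) (g (f x)) by split=> //; exists (f x).
rewrite -gW => -[y [By Vy] /(ginj _ _ By Bfx) yfx]; subst y.
have : (f @` A `&` V) (f x) by split=> //; exists x.
rewrite -fV => -[z [Az [_ Oz]] /(finj _ _ Az Ax) zx]; subst z.
by exists x.
Qed.

(** * Smooth maps, differentials and embeddings in charts *)

Section Charts.
Variables (R : realType) (M : topologicalType) (n : nat) (c : chart R M n).

Lemma open_chart_image (W : set M) : open W -> W `<=` cdom c -> open (c @` W).
Proof.
move=> oW Wc; rewrite (_ : c @` W = c @` cdom c `&` cinv c @^-1` W).
  exact: open_setI_preimage (@cimg_open _ _ _ c) (@cinv_continuous _ _ _ c) oW.
apply/seteqP; split=> [_ [x Wx <-]|_ [[x cx <-]]].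
  by split; [exists x => //; exact: Wc|rewrite /= cmapK //; exact: Wc].
by rewrite /= cmapK // => Wx; exists x.
Qed.

Lemma near_chart (P : M -> Prop) x : cdom c x ->
  (\near x, P x) -> \forall y \near c x, P (cinv c y).
Proof.
move=> cx Px; have := @cinv_continuous _ _ _ c (c x).
by rewrite /prop_for /continuous_at cmapK //; apply=> //; exists x.
Qed.

End Charts.

Section Manifolds.
Variable R : realType.
Implicit Types M N P : manifold R.

Lemma chart_at_atlas M (x : M) : atlas M (chart_at x).
Proof. exact: (s2valP (cid2 (atlas_cover x))). Qed.

Lemma chart_at_dom M (x : M) : cdom (chart_at x) x.
Proof. exact: (s2valP' (cid2 (atlas_cover x))). Qed.

Lemma smooth_fun_sub M (E : vectType R) (A B : set M) (s : M -> E) :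
  B `<=` A -> smooth_fun A s -> smooth_fun B s.
Proof.
move=> BA sA c ac k; apply: sub_Ck_on (sA c ac k) => _ [x [Bx cx] <-].
by exists x => //; split=> //; exact: BA.
Qed.

(** No single chart of [N] need contain the image of the region read in [c] and [c'']. The claim is
    therefore localized at each [x], where a chart around [f x] serves as the intermediate one. *)
Lemma smooth_map_comp M N P (A : set M) (B : set N) (f : M -> N) (g : N -> P) :
  open A -> open B -> smooth_map A f -> smooth_map B g ->
  smooth_map (A `&` f @^-1` B) (g \o f).
Proof.
move=> oA oB [cf sf] [cg sg]; split=> [x [Ax Bfx]|c c'' ac ac'' k].
  exact: continuous_comp (cf x Ax) (cg _ Bfx).
apply: Ck_on_set1 => _ [x [[[Ax Bfx] cx] gfx] <-].
pose c' := chart_at (f x).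
(* On the open neighbourhood [W] of [x], [f] lands in [V], so the composite read in [c] and [c'']
   factors through [c']. *)
pose V := B `&` cdom c' `&` g @^-1` cdom c''.
pose W := A `&` cdom c `&` f @^-1` V.
have oV : open V.
  apply: open_setI_preimage; [|by move=> y [By _]; exact: cg|exact: cdom_open].
  by apply: openI => //; exact: cdom_open.
have oW : open W.
  apply: open_setI_preimage oV; last by move=> y [Ay _]; exact: cf.
  by apply: openI => //; exact: cdom_open.
have ocW : open (c @` W) by apply: open_chart_image => // y [[]].
have cWx : (c @` W) (c x).
  by exists x => //; do 3![split=> //]; exact: chart_at_dom.
suff : Ck_on k (c @` W) (c'' \o (g \o f) \o cinv c).
  by apply: sub_Ck_on => _ ->.
apply: (@eq_Ck_on _ _ _ _ _ ((c'' \o g \o cinv c') \o (c' \o f \o cinv c))) => //.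
  move=> _ /set_mem[y [[Ay cy] [[By c'y] _]] <-] /=.
  by rewrite cmapK // cmapK.
apply: Ck_on_comp (sg _ _ (chart_at_atlas (f x)) ac'' k) => //.
  move=> _ [y [[Ay cy] Vfy] <-]; exists (f y) => //=; by rewrite cmapK.
apply: sub_Ck_on (sf _ _ ac (chart_at_atlas (f x)) k).
by move=> _ [y [[Ay cy] [[_ c'y] _]] <-]; exists y.
Qed.

Lemma smooth_map_differentiable M N (A : set M) (f : M -> N) x :
  smooth_map A f -> A x ->
  differentiable (chart_at (f x) \o f \o cinv (chart_at x)) (chart_at x x).
Proof.
move=> [_ sf] Ax; have [] := sf _ _ (chart_at_atlas x) (chart_at_atlas (f x)) 1%N.
move=> + _; apply; exists x => //; split; [split|]; rewrite //=.
  exact: chart_at_dom.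
exact: chart_at_dom.
Qed.

(** Both factors read [N] through the same chart [chart_at (f x)], so it cancels and no transition
    map appears. *)
Lemma mdiff_comp M N P (A : set M) (B : set N) (f : M -> N) (g : N -> P) x :
  smooth_map A f -> smooth_map B g -> A x -> B (f x) ->
  mdiff (g \o f) x = (mdiff g (f x) \o mdiff f x)%VF.
Proof.
move=> sf sg Ax Bfx; have df := smooth_map_differentiable sf Ax.
have dg := smooth_map_differentiable sg Bfx.
set c := chart_at x in df *; set c' := chart_at (f x) in df dg *.
set c'' := chart_at (g (f x)) in dg *.
have fx : (c' \o f \o cinv c) (c x) = c' (f x).
  by rewrite /= cmapK //; exact: chart_at_dom.
rewrite -fx in dg.
(* [cinv c'] undoes [c'] only where [f] lands in [cdom c'], so the two local expressions agree only
   near [c x]; that suffices for their differentials. *)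
have ffg : {near c x,
    (c'' \o g \o cinv c') \o (c' \o f \o cinv c) =1 c'' \o (g \o f) \o cinv c}.
  have : \forall y \near x, cdom c' (f y).
    apply: (sf.1 x Ax); apply: open_nbhs_nbhs; split; first exact: cdom_open.
    exact: chart_at_dom.
  move/(near_chart (chart_at_dom x)); apply: filterS => y c'fy /=.
  by rewrite cmapK.
apply/lfunP => v; rewrite comp_lfunE !lfunE.
rewrite (near_eq_diff ffg); last exact: differentiable_comp.
by rewrite (diff_comp df dg) [LHS]/comp fx.
Qed.

Lemma smooth_embedding_comp M N P (A : set M) (B : set N) (f : M -> N)
    (g : N -> P) : open A -> open B ->
  smooth_embedding A f -> smooth_embedding B g ->
  smooth_embedding (A `&` f @^-1` B) (g \o f).
Proof.
move=> oA oB [sf kf hf] [sg kg hg]; split; first exact: smooth_map_comp.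
  move=> x [Ax Bfx]; rewrite (mdiff_comp sf sg Ax Bfx); apply/eqP/lker0P.
  have /eqP/lker0P finj := kf _ Ax; have /eqP/lker0P ginj := kg _ Bfx.
  by move=> u v; rewrite !comp_lfunE => /ginj /finj.
by apply: homeo_onto_comp => //; [case: sf|case: sg].
Qed.

End Manifolds.

(** * Composition of coordinate changes *)

Section CoordinateChanges.
Variables (R : realType) (X : topologicalType).
Variables KI KJ KL : kuranishi_chart R X.

(* [kzero] alone denotes the zero kernel of MathComp-Analysis. *)
Lemma open_is_restriction (F : set X) (U : set (kdom KI)) :
  open F -> F `<=` kfoot KI -> F !=set0 -> open U ->
  U `&` Defs.kzero KI = Defs.kzero KI `&` kpsi KI @^-1` F -> is_restriction KI F U.
Proof.
move=> oF FK F0 oU UF; split=> //.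
have [_ sK _ _ hK] := kuranishiP KI; split=> //; first exact: smooth_fun_sub sK.
rewrite -[_ @^-1` _]/(Defs.kzero KI) UF -[Defs.kzero KI]setTI.
exact: homeo_onto_restrict FK hK.
Qed.

Variables (UIJ : set (kdom KI)) (phiIJ : kdom KI -> kdom KJ).
Variable hphiIJ : 'Hom(kobs KI, kobs KJ).
Variables (UJL : set (kdom KJ)) (phiJL : kdom KJ -> kdom KL).
Variable hphiJL : 'Hom(kobs KJ, kobs KL).
Hypothesis ccIJ : coordinate_change KI KJ UIJ phiIJ hphiIJ.
Hypothesis ccJL : coordinate_change KJ KL UJL phiJL hphiJL.
Hypothesis FILne : kfoot KI `&` kfoot KL !=set0.
Hypothesis FILJ : kfoot KI `&` kfoot KL `<=` kfoot KJ.

Lemma is_restriction_comp :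
  is_restriction KI (kfoot KI `&` kfoot KL) (UIJ `&` phiIJ @^-1` UJL).
Proof.
have [[_ [_ _ oUIJ zIJ _]] [[sIJ _ _] _] _ psiIJ _] := ccIJ.
have [[_ [_ _ oUJL zJL _]] _ _ _ _] := ccJL.
have [_ _ oFI _ _] := kuranishiP KI; have [_ _ oFL _ _] := kuranishiP KL.
apply: open_is_restriction => //; first exact: openI.
  by apply: open_setI_preimage oUJL => //; case: sIJ.
apply/seteqP; split=> u.
  move=> [[UIJu UJLu] z]; split=> //.
  (* [zIJ] places [u] over [F_I]; [zJL] places [phiIJ u] over [F_L], and both points have the same
     image in [X]. *)
  have [_ [FIu _]] : (Defs.kzero KI `&` kpsi KI @^-1` (kfoot KI `&` kfoot KJ)) u.
    by rewrite -zIJ.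
  have [zJ psiu] := psiIJ u UIJu z.
  have [_ [_ FLu]] :
      (Defs.kzero KJ `&` kpsi KJ @^-1` (kfoot KJ `&` kfoot KL)) (phiIJ u).
    by rewrite -zJL.
  by split=> //; rewrite -psiu.
(* The inclusion [FILJ] puts the footprint point in [F_J], so [zIJ] yields [UIJ u]; only then can
   [psiIJ] and [zJL] be applied. *)
move=> [z [FIu FLu]]; have FJu := FILJ (conj FIu FLu).
have [UIJu _] : (UIJ `&` Defs.kzero KI) u by rewrite zIJ.
have [zJ psiu] := psiIJ u UIJu z.
suff [UJLu _] : (UJL `&` Defs.kzero KJ) (phiIJ u) by [].
by rewrite zJL; split=> //; rewrite /= psiu.
Qed.

Lemma coordinate_change_comp :
  coordinate_change KI KL (UIJ `&` phiIJ @^-1` UJL) (phiJL \o phiIJ)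
    (hphiJL \o hphiIJ)%VF.
Proof.
have [[_ [_ _ oUIJ _ _]] [eIJ kIJ] sIJ psiIJ iIJ] := ccIJ.
have [[_ [_ _ oUJL _ _]] [eJL kJL] sJL psiJL iJL] := ccJL.
split.
- by split=> //; exact: is_restriction_comp.
- split; first exact: smooth_embedding_comp.
  move/eqP/lker0P: kIJ => injIJ; move/eqP/lker0P: kJL => injJL.
  by apply/eqP/lker0P => u v; rewrite !comp_lfunE => /injJL /injIJ.
- by move=> u [UIJu UJLu]; rewrite /= sJL // sIJ // comp_lfunE.
- move=> u [UIJu UJLu] z; have [zJ psiu] := psiIJ u UIJu z.
  by have [zL psiu'] := psiJL _ UJLu zJ; rewrite /= psiu'.
(* Kernels are transported in two stages by the chain rule. A complement [C] at [u] gives the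
   complement [hphiIJ @: C] at [phiIJ u], to which the condition for [phiJL] applies. *)
move=> u [UIJu UJLu]; have [keIJ imIJ] := iIJ u UIJu.
have [keJL imJL] := iJL _ UJLu; split=> [|C dC].
  have [smIJ _ _] := eIJ; have [smJL _ _] := eJL.
  by rewrite (mdiff_comp smIJ smJL UIJu UJLu) limg_comp keIJ keJL.
by rewrite limg_comp; apply: imJL; exact: imIJ.
Qed.

End CoordinateChanges.

Theorem lemma5p2p7 (R : realType) (X : topologicalType)
    (Xcompact : compact [set: X]) (Xmetrizable : metrizable R X)
    (KI KJ KL : kuranishi_chart R X)
    (UIJ : set (kdom KI)) (phiIJ : kdom KI -> kdom KJ)
    (hphiIJ : 'Hom(kobs KI, kobs KJ))
    (UJL : set (kdom KJ)) (phiJL : kdom KJ -> kdom KL)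
    (hphiJL : 'Hom(kobs KJ, kobs KL))
    (FILne : kfoot KI `&` kfoot KL !=set0)
    (FILJ : kfoot KI `&` kfoot KL `<=` kfoot KJ)
    (ccIJ : coordinate_change KI KJ UIJ phiIJ hphiIJ)
    (ccJL : coordinate_change KJ KL UJL phiJL hphiJL) :
  let UIJL := UIJ `&` phiIJ @^-1` UJL in
  is_restriction KI (kfoot KI `&` kfoot KL) UIJL /\
  coordinate_change KI KL UIJL (phiJL \o phiIJ) (hphiJL \o hphiIJ)%VF.
Proof.
move=> UIJL; split; first exact: is_restriction_comp ccIJ ccJL FILne FILJ.
exact: coordinate_change_comp.
Qed.
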